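(* Let $k\ge 0$ be an integer and let $\alpha(k,p)$ denote the lexicographically minimal critical string of a $k$-mismatch search scheme with $p$ parts (definitions in the context). Then: (a) if $k$ is odd, $\alpha(k,k+1)$ is the string $0\,1\,3\,3\,5\,5\cdots k\,k$ of length $k+1$ (i.e. $0,1$ followed by the pairs $(3,3),(5,5),\dots,(k,k)$); (b) if $k$ is even, $\alpha(k,k+1)$ is the string $0\,2\,2\,4\,4\cdots k\,k$ of length $k+1$ (i.e. $0$ followed by the pairs $(2,2),(4,4),\dots,(k,k)$).
   Context: Fix integers $k\ge 0$ and $p\ge 1$. A search (with $p$ parts and at most $k$ errors) is a triple $S=(\pi,L,U)$ where $\pi=\pi(1)\cdots\pi(p)$ is a permutation of $\{1,\dots,p\}$ written as a string and satisfying the connectivity property: for every $i>1$, $\pi(i)$ equals either $\min_{j<i}\pi(j)-1$ or $\max_{j<i}\pi(j)+1$; and $L,U$ are strings of length $p$ over $\{0,\dots,k\}$. For a string $A$ of length $p$ over the nonnegative integers, its weight is $\sum_i A[i]$. The search $S$ covers $A$ if $L[i+1]\le \sum_{j=1}^{i} A[\pi(j)]\le U[i]$ for all $i=1,\dots,p$, with the convention $L[p+1]=0$. A $k$-mismatch search scheme with $p$ parts is a finite set $\mathcal S$ of such searches such that every string $A$ of length $p$ over the nonnegative integers of weight exactly $k$ is covered by some search in $\mathcal S$. The critical string of $\mathcal S$ is the lexicographically maximal $U$-string among the searches of $\mathcal S$. $\alpha(k,p)$ is the lexicographically minimal critical string over all $k$-mismatch search schemes with $p$ parts. *)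

(* Defs.v *)
From HB Require Import structures.
From mathcomp Require Import all_boot all_order all_fingroup.

Set Implicit Arguments.
Unset Strict Implicit.
Unset Printing Implicit Defensive.

Import Order.TTheory.

(* Parts and positions are numbered 0, ..., p-1 instead of 1, ..., p.  Strings
   over {0, ..., k} are tuples over 'I_k.+1, strings over the nonnegative
   integers are tuples over nat. *)

(* p is a neutral starting value for the minimum since all parts are < p.  The
   condition "pi i = min - 1" is written without truncated subtraction. *)
Definition connectivity p (pi : {perm 'I_p}) : bool :=
  [forall i : 'I_p, (0 < i) ==>
     ((pi i).+1 == \big[minn/p]_(j < p | j < i) pi j) ||
     (pi i == (\max_(j < p | j < i) pi j).+1 :> nat)].

Definition search (k p : nat) : Type :=
  {S : {perm 'I_p} * p.-tuple 'I_k.+1 * p.-tuple 'I_k.+1 | connectivity S.1.1}.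

Definition search_perm k p (S : search k p) : {perm 'I_p} := (val S).1.1.
Definition search_L k p (S : search k p) : seq nat := map val (val S).1.2.
Definition search_U k p (S : search k p) : seq nat := map val (val S).2.

Definition weight p (A : p.-tuple nat) : nat := \sum_(i < p) tnth A i.

(* The lower bound is read one position further along L; for the last position
   the default value 0 of nth stands for the missing letter. *)
Definition covers k p (S : search k p) (A : p.-tuple nat) : Prop :=
  forall i : 'I_p,
    nth 0 (search_L S) i.+1
      <= \sum_(j < p | j <= i) tnth A (search_perm S j)
      <= nth 0 (search_U S) i.

Definition is_scheme k p (SS : {set search k p}) : Prop :=
  forall A : p.-tuple nat, weight A = k -> exists2 S, S \in SS & covers S A.

Definition lexle (s t : seq nat) : bool :=
  ((s : seqlexi nat) <= (t : seqlexi nat))%O.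

Definition is_critical k p (SS : {set search k p}) (c : seq nat) : Prop :=
  (exists2 S, S \in SS & search_U S = c) /\
  (forall S, S \in SS -> lexle (search_U S) c).

(* is_alpha k p a means that a is the string alpha(k, p). *)
Definition is_alpha (k p : nat) (a : seq nat) : Prop :=
  (exists2 SS : {set search k p}, is_scheme SS & is_critical SS a) /\
  (forall (SS : {set search k p}) (c : seq nat),
     is_scheme SS -> is_critical SS c -> lexle a c).

Lemma is_critical_unique k p (SS : {set search k p}) (c d : seq nat) :
  is_critical SS c -> is_critical SS d -> c = d.
Proof.
move=> [[S SSS <-] cmax] [[T TSS <-] dmax].
by apply: (@le_anti _ (seqlexi nat)); apply/andP; split; [apply: dmax | apply: cmax].
Qed.

Lemma is_alpha_unique (k p : nat) (a b : seq nat) :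
  is_alpha k p a -> is_alpha k p b -> a = b.
Proof.
move=> [[SS sSS cSS] amin] [[TT sTT cTT] bmin].
by apply: (@le_anti _ (seqlexi nat)); apply/andP; split;
  [apply: amin cTT | apply: bmin cSS].
Qed.

(* Main.v *)
(* For a string A and a connected permutation pi let T(A, pi) be the string of
   partial sums of A along pi.  Lower bounds do not help a search, so alpha(k, p)
   is the lexicographic maximum over A of the minimum over pi of T(A, pi).

   The hard strings are the increments of the claimed value: 0 2 0 2 ... 0 for k
   even, 0 1 2 0 2 0 ... 2 0 for k odd.

   For the other bound let A have length k + 1 and weight k.  If some window of
   length 2 (k even) or 3 (k odd) is light, starting there already gives a smaller
   string.  Otherwise call each 0, together with an adjacent 1 if there is one, a
   token: a token has weight one less than its length, and what separates two
   tokens has weight at least one more than its length.  As the total deficit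
   is 1, A is an alternation of tokens and single letters 2.  For k even this is
   0 2 0 2 ... 0.  For k odd the length is even, so the number of two-letter tokens
   is odd.  If there is one, start from it; if there are more, some two consecutive
   ones are such that going from one of them to the other meets 0 before 1, and
   the string of partial sums drops below the claimed one there. *)

Require Import Defs.
From HB Require Import structures.
From mathcomp Require Import all_boot all_order all_fingroup.
From mathcomp Require Import zify.

Set Implicit Arguments.
Unset Strict Implicit.
Unset Printing Implicit Defensive.

Import Order.TTheory.

(** * Lexicographic comparison and the claimed strings *)

Lemma lexle_cons x y (s t : seq nat) :
  lexle (x :: s) (y :: t) = (x < y) || (x == y) && lexle s t.
Proof.
rewrite /lexle lexi_cons !leEnat; case: ltngtP => //= _.
Qed.

Lemma lexle_refl s : lexle s s.
Proof. exact: (@le_refl _ (seqlexi nat)). Qed.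

Lemma lexle_anti s t : lexle s t -> lexle t s -> s = t.
Proof. by move=> le_st le_ts; apply: (@le_anti _ (seqlexi nat)); apply/andP. Qed.

Lemma lexle_of_nth s t : size s = size t ->
  (forall i, i < size s -> (forall j, j < i -> nth 0 s j = nth 0 t j) ->
     nth 0 s i <= nth 0 t i) ->
  lexle s t.
Proof.
elim: s t => [|x s IHs] [|y t] //= [eq_sz] le_st; rewrite lexle_cons.
have := le_st 0 isT (fun j => ltac:(by [])).
rewrite /= leq_eqVlt => /orP[/eqP eq_xy | ->] //.
rewrite eq_xy eqxx /= IHs ?orbT // => i lt_i eq_lt; apply: (le_st i.+1) => //.
by case=> [|j] //= /eq_lt.
Qed.

(** The claimed values are [0 :: stairs 0 r] for k even and [[:: 0, 1 & stairs 1 r]] for k odd. *)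
Fixpoint stairs (t r : nat) : seq nat :=
  if r is r'.+1 then [:: t.+2, t.+2 & stairs t.+2 r'] else [::].

Lemma size_stairs t r : size (stairs t r) = r.*2.
Proof. by elim: r t => //= r IHr t; rewrite IHr. Qed.

Lemma nth_stairs t r i : i < r.*2 -> nth 0 (stairs t r) i = t + i./2.*2.+2.
Proof.
elim: r t i => //= r IHr t [|[|i]] /=; rewrite ?addn2 // => lt_i.
by rewrite IHr //; lia.
Qed.

Lemma stairs_even a r :
  flatten [seq [:: m.*2; m.*2] | m <- iota a.+1 r] = stairs a.*2 r.
Proof. by elim: r a => //= r IHr a; rewrite IHr. Qed.

Lemma stairs_odd a r :
  flatten [seq [:: m.*2.+1; m.*2.+1] | m <- iota a.+1 r] = stairs a.*2.+1 r.
Proof. by elim: r a => //= r IHr a; rewrite IHr. Qed.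

(** * Partial sums along connected orders *)

(* The interval explored so far has sum t; u is what remains to its left, read
   leftwards, v what remains to its right, and w lists the later partial sums. *)
Inductive trace : nat -> seq nat -> seq nat -> seq nat -> Prop :=
| trace_nil t : trace t [::] [::] [::]
| trace_l t x u v w : trace (t + x) u v w -> trace t (x :: u) v (t + x :: w)
| trace_r t x u v w : trace (t + x) u v w -> trace t u (x :: v) (t + x :: w).

Lemma trace_sym t u v w : trace t u v w -> trace t v u w.
Proof. by elim=> *; constructor. Qed.

Lemma trace_exists t u v : exists w, trace t u v w.
Proof.
elim: u t => [|x u IHu] t.
  elim: v t => [|x v IHv] t; first by exists [::]; constructor.
  by case: (IHv (t + x)) => w tr_w; exists (t + x :: w); constructor.
by case: (IHu (t + x)) => w tr_w; exists (t + x :: w); constructor.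
Qed.

Lemma trace_size t u v w : trace t u v w -> size w = size u + size v.
Proof. by elim=> //= *; lia. Qed.

Lemma trace_bound t u v w :
  trace t u v w -> forall x, x \in w -> x <= t + sumn u + sumn v.
Proof.
elim=> // {}t x {}u {}v {}w _ IH y; rewrite inE /= => /predU1P[->|/IH]; lia.
Qed.

(** The cut between [u] and [v] is the place next to which a connected order starts, so this bounds
    the minimum over pi of T(s, pi) by [a]. *)
Definition reaches (s a : seq nat) : Prop :=
  exists u v w, [/\ s = rev u ++ v, trace 0 u v w & lexle w a].

Lemma reaches_rev s a : reaches s a -> reaches (rev s) a.
Proof.
case=> u [v [w [-> tr_w le_wa]]]; exists v, u, w; split=> //; last exact: trace_sym.
by rewrite rev_cat revK.
Qed.

Fixpoint twos (n : nat) : seq nat :=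
  if n is n'.+1 then [:: 2, 0 & twos n'] else [::].

Lemma size_twos n : size (twos n) = n.*2.
Proof. by elim: n => //= n ->. Qed.

Lemma twosS n : twos n.+1 = twos n ++ [:: 2; 0].
Proof. by elim: n => //= n ->. Qed.

Lemma rev_twosS n : rev (twos n.+1) = [:: 0, 2 & rev (twos n)].
Proof. by rewrite twosS rev_cat. Qed.

Lemma cons_rev_twos n : 2 :: rev (twos n) = twos n ++ [:: 2].
Proof.
by elim: n => // n IHn; rewrite rev_twosS IHn.
Qed.

(** Both sides are read outwards, so a 2 always comes with the 0 behind it; from either side such a
    pair contributes t + 2 twice. *)
Lemma trace_twos t m n : trace t (twos m) (twos n) (stairs t (m + n)).
Proof.
elim: n t => [|n IHn] t.
  elim: m t => [|m IHm] t; first exact: trace_nil.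
  have [e2 e0] : t.+2 = t + 2 /\ t + 2 = t + 2 + 0 by lia.
  by rewrite addSn /= e2 {2}e0; do 2!constructor; rewrite addn0; apply: IHm.
have [e2 e0] : t.+2 = t + 2 /\ t + 2 = t + 2 + 0 by lia.
by rewrite addnS /= e2 {2}e0; do 2!constructor; rewrite addn0; apply: IHn.
Qed.

(** * Light windows and the even case *)

Fixpoint has_suffix (P : pred (seq nat)) (s : seq nat) : bool :=
  P s || (if s is _ :: s' then has_suffix P s' else false).

Lemma has_suffixP (P : pred (seq nat)) s :
  has_suffix P s -> exists s1 s2, s = s1 ++ s2 /\ P s2.
Proof.
elim: s => [|x s IHs] /= /orP[Ps|] //; try by exists [::]; eexists; split; last exact: Ps.
by move=> /IHs[s1 [s2 [-> Ps2]]]; exists (x :: s1), s2.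
Qed.

(** Only the head is inspected; [has_suffix] slides the window along the string. *)
Definition light2 (s : seq nat) : bool :=
  if s is [:: x, y & _] then x + y <= 1 else false.

(** A light window holds a 0. Starting there and taking the other letter next gives 0, then at most
    1. *)
Lemma reaches_light2 s c a :
  has_suffix light2 s -> 1 < c -> reaches s [:: 0, c & a].
Proof.
move=> /has_suffixP[s1 [[|x [|y s2]] [-> //= le_xy1]]] c_gt1.
have [x0 | y0] : x = 0 \/ y = 0 by lia.
  subst x; have [w tr_w] := trace_exists y (rev s1) s2.
  exists (rev s1), [:: 0, y & s2], [:: 0, y & w].
  split; [by rewrite revK | by do 2!constructor |].
  by rewrite !lexle_cons /=; apply/orP; left; lia.
subst y; have [w tr_w] := trace_exists x (rev s1) s2.
exists (x :: rev s1), (0 :: s2), [:: 0, x & w].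
split; [by rewrite rev_cons revK cat_rcons | by do 2!constructor |].
by rewrite !lexle_cons /=; apply/orP; left; lia.
Qed.

(** [0 0] counts whatever follows, as 0, 0 is already below 0, 1. Otherwise the sum rules out
    [1 1 1], so the window holds a 0, and starting there gives 0, then at most 1, then at most 2. *)
Definition light3 (s : seq nat) : bool :=
  match s with
  | [:: 0, 0 & _] => true
  | [:: x, y, z & _] => [&& x <= 1, y <= 1, z <= 1 & x + y + z <= 2]
  | _ => false
  end.

Lemma reaches_light3 s c a :
  has_suffix light3 s -> 2 < c -> reaches s [:: 0, 1, c & a].
Proof.
have lt_c p q w : 2 < c -> p <= 1 -> q <= 2 -> lexle [:: 0, p, q & w] [:: 0, 1, c & a].
  move=> c_gt2 p_le1 q_le2; rewrite !lexle_cons /=.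
  case: (ltnP p 1) => //= p_ge1; have -> : p = 1 by lia.
  by rewrite eqxx /=; apply/orP; left; lia.
move=> /has_suffixP[s1 [s2 [-> light_s2]]] c_gt2.
have [[s3 def_s2] | [x [y [z [s3 [def_s2 x1 y1 z1 xyz2]]]]]] :
    (exists s3, s2 = [:: 0, 0 & s3]) \/
    (exists x y z s3, [/\ s2 = [:: x, y, z & s3], x <= 1, y <= 1, z <= 1 & x + y + z <= 2]).
- case: s2 light_s2 => [|[|x] [|[|y] [|z s2]]] // light_s2; try by (left; eexists).
  1-3: by (right; do 4!eexists; split; first reflexivity; move: light_s2 => /=; lia).
- subst s2; have [w tr_w] := trace_exists 0 (rev s1) s3.
  exists (rev s1), [:: 0, 0 & s3], [:: 0, 0 & w].
  split; [by rewrite revK | by do 2!constructor |].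
  by rewrite !lexle_cons.
subst s2.
have [x0 | [y0 | z0]] : x = 0 \/ y = 0 \/ z = 0 by lia.
- subst x; have [w tr_w] := trace_exists (y + z) (rev s1) s3.
  exists (rev s1), [:: 0, y, z & s3], [:: 0, y, y + z & w].
  by split; [rewrite revK | do 3!constructor | apply: lt_c; lia].
- subst y; have [w tr_w] := trace_exists (x + z) (rev s1) s3.
  exists (x :: rev s1), [:: 0, z & s3], [:: 0, x, x + z & w].
  by split; [rewrite rev_cons revK cat_rcons | do 3!constructor | apply: lt_c; lia].
subst z; have [w tr_w] := trace_exists (y + x) (rev s1) s3.
exists [:: y, x & rev s1], (0 :: s3), [:: 0, y, y + x & w].
by split; [rewrite !rev_cons revK !cat_rcons | do 3!constructor | apply: lt_c; lia].
Qed.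

(** Induction on the length: a leading 0 is removed together with the next letter, which is at least
    2. So size minus sum never exceeds 1, and it is 1 only for an exact alternation. *)
Lemma heavy2_structure s : ~~ has_suffix light2 s ->
  size s <= sumn s \/ exists n, s = 0 :: twos n.
Proof.
have [m] := ubnP (size s); elim: m s => // m IHm [|x s] /=; first by left.
rewrite ltnS negb_or => le_s_m /andP[heavy_s heavy_s'].
have [le_s | [n def_s]] := IHm s le_s_m heavy_s'; last first.
  subst s; move: heavy_s; rewrite /= size_twos => heavy_s.
  have -> : sumn (twos n) = n.*2 by elim: (n) => //= ? ->.
  by left; lia.
have [x_gt0 | x0] : 0 < x \/ x = 0 by lia.
  by left; lia.
subst x; case: s le_s_m heavy_s heavy_s' le_s => [|y s] /=; first by right; exists 0.
rewrite add0n negb_or => le_s_m heavy_s /andP[_ heavy_s'] le_s.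
have [le_s' | [n def_s]] := IHm s (ltnW le_s_m) heavy_s'; first by left; lia.
subst s; have -> : sumn (0 :: twos n) = n.*2 by elim: (n) => //= ? /= ->.
rewrite /= size_twos; have [y2 | y_gt2] : y = 2 \/ 2 < y by lia.
  by right; exists n.+1; rewrite y2.
by left; lia.
Qed.

Lemma even_reaches r s : sumn s = r.*2 -> size s = r.*2.+1 ->
  reaches s (0 :: stairs 0 r).
Proof.
move=> sum_s size_s; case: (boolP (has_suffix light2 s)) => [light_s | heavy_s].
  (* For [r = 0] there is no second letter to undercut, but a single letter has no window of length
     2. *)
  case: r sum_s size_s => [|r] sum_s size_s.
    by case: s size_s light_s {sum_s} => [|x []].
  exact: reaches_light2.
have [|[n def_s]] := heavy2_structure heavy_s; first by lia.
exists [::], s, (0 :: stairs 0 r); split; rewrite ?lexle_refl //.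
have -> : r = n by move: size_s; rewrite def_s /= size_twos; lia.
by rewrite def_s; constructor; apply: (trace_twos 0 0 n).
Qed.

(** * Tokens, alternations and the odd case *)

Definition is_pair (q : seq nat) : bool := (q == [:: 0; 1]) || (q == [:: 1; 0]).

Inductive alternating : seq nat -> Prop :=
| alt_token q : (q == [:: 0]) || is_pair q -> alternating q
| alt_cat q s : (q == [:: 0]) || is_pair q -> alternating s ->
    alternating (q ++ 2 :: s).

Lemma alternating_sum s : alternating s -> size s = (sumn s).+1.
Proof.
elim=> [q | q {}s]; rewrite /is_pair => /or3P[] /eqP-> //= s_alt /= IHs; lia.
Qed.

Lemma heavy3_structure s : ~~ has_suffix light3 s ->
  size s <= sumn s \/ alternating s.
Proof.
have [m] := ubnP (size s); elim: m s => // m IHm [|x s] /=; first by left.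
rewrite ltnS negb_or => le_s_m /andP[heavy_xs heavy_s].
(* The deficits of [q] and [t] are at most 1 each and [z] gives back at least 1; a total deficit of
   1 forces [z = 2]. *)
have step (q : seq nat) z t : (q == [:: 0]) || is_pair q -> 1 < z -> size t < m ->
    ~~ has_suffix light3 t ->
    size (q ++ z :: t) <= sumn (q ++ z :: t) \/ alternating (q ++ z :: t).
  move=> token_q z_gt1 le_t_m heavy_t; rewrite size_cat sumn_cat /=.
  have /eqP size_q : size q == (sumn q).+1 by case/or3P: token_q => /eqP->.
  have [le_t | alt_t] := IHm t le_t_m heavy_t; first by left; lia.
  have size_t := alternating_sum alt_t.
  have [z2 | z_gt2] : z = 2 \/ 2 < z by lia.
    by right; rewrite z2; constructor.
  by left; lia.
case: x heavy_xs => [|[|x]] heavy_xs.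
- case: s le_s_m heavy_s heavy_xs => [|[|[|y]] s] //= le_s_m heavy_s heavy_xs.
  + by right; constructor.
  + case: s le_s_m heavy_s heavy_xs => [|z s] /= le_s_m heavy_s heavy_xs.
      by right; constructor.
    move: heavy_s; rewrite !negb_or => /and3P[_ _ heavy_s].
    by apply: (step [:: 0; 1] z s) => //; lia.
  move: heavy_s; rewrite !negb_or => /andP[_ heavy_s].
  by apply: (step [:: 0] y.+2 s) => //; lia.
- have [le_s | alt_s] := IHm s le_s_m heavy_s; first by left; lia.
  (* If the tail starts with 0, the leading 1 joins it in a token; if it starts with [1 0], then
     [1 1 0] is a light window. *)
  have [[t def_s] | [t def_s]] : (exists t, s = 0 :: t) \/ (exists t, s = [:: 1, 0 & t]).
  + by case: alt_s => [q | q t]; rewrite /is_pair => /or3P[] /eqP-> //= *;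
      by [left; eexists | right; eexists].
  + subst s; case: t le_s_m heavy_s heavy_xs {alt_s} => [|z t] /= le_s_m heavy_s heavy_xs.
      by right; constructor.
    move: heavy_s; rewrite !negb_or => /and3P[_ _ heavy_s].
    by apply: (step [:: 1; 0] z t) => //; lia.
  by subst s.
have [le_s | /alternating_sum size_s] := IHm s le_s_m heavy_s; by left; lia.
Qed.

(* A walk that leaves the pair q to the right falls below stairs at the final 1. *)
Definition good_factor (s : seq nat) : Prop :=
  exists s1 s2 q n, is_pair q /\
    s = s1 ++ q ++ twos n ++ [:: 2, 0, 1 & s2].

(** The walk agrees with [stairs] for n + 1 pairs, then adds 1 where [stairs] rises by 2; [n.+1 < r]
    ensures that [stairs] has not ended there. *)
Lemma trace_twos_good t n r u s : n.+1 < r ->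
  exists2 w, trace t u (twos n ++ [:: 2, 0, 1 & s]) w & lexle w (stairs t r).
Proof.
elim: n t r => [|n IHn] t [//|r] lt_nr.
  case: r lt_nr => // r _; have [w tr_w] := trace_exists (t + 2 + 0 + 1) u s.
  exists [:: t + 2, t + 2 + 0, t + 2 + 0 + 1 & w]; first by do 3!constructor.
  by rewrite /= !lexle_cons !addn0 !addn2 !ltnn !eqxx /=; apply/orP; left; lia.
have [w tr_w le_w] := IHn t.+2 r lt_nr.
exists [:: t + 2, t + 2 + 0 & w].
  by do 2!constructor; rewrite addn0 addn2.
by rewrite /= !lexle_cons !addn0 !addn2 !eqxx le_w !orbT.
Qed.

Lemma reaches_good s r : good_factor s -> size s = r.*2.+2 ->
  reaches s [:: 0, 1 & stairs 1 r].
Proof.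
case=> s1 [s2 [q [n [pair_q ->]]]]; rewrite !size_cat /= size_twos => size_s.
(* Counting letters gives 2n + 5 <= 2r + 2, which by parity means n + 2 <= r. *)
have lt_nr : n.+1 < r by case/orP: pair_q size_s => /eqP-> /=; lia.
case/orP: pair_q => /eqP->.
  have [w tr_w le_w] := trace_twos_good 1 (rev s1) s2 lt_nr.
  exists (rev s1), ([:: 0; 1] ++ twos n ++ [:: 2, 0, 1 & s2]), [:: 0, 1 & w].
  by split; [rewrite revK | do 2!constructor | rewrite !lexle_cons le_w].
have [w tr_w le_w] := trace_twos_good 1 (rev s1) s2 lt_nr.
exists (1 :: rev s1), (0 :: twos n ++ [:: 2, 0, 1 & s2]), [:: 0, 1 & w].
split; [by rewrite rev_cons revK cat_rcons | by do 2!constructor | by rewrite !lexle_cons le_w].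
Qed.

Lemma rev_pair q : is_pair q -> is_pair (rev q).
Proof. by case/orP=> /eqP->. Qed.

Lemma good_factor_cat s t : good_factor t -> good_factor (s ++ t).
Proof.
by case=> s1 [s2 [q [n [pair_q ->]]]]; exists (s ++ s1), s2, q, n; rewrite !catA.
Qed.

Lemma good_factor_rev_cat s t : good_factor (rev t) -> good_factor (rev (s ++ t)).
Proof.
case=> s1 [s2 [q [n [pair_q def_t]]]]; exists s1, (s2 ++ rev s), q, n.
by split=> //; rewrite rev_cat def_t -!catA.
Qed.

(** The size is odd exactly when the number of pairs is even. The odd outcomes carry the induction:
    no pair at all, or a first pair [0 1], which makes a good factor with the next pair put in
    front. The third outcome has exactly one pair. *)
Lemma alternating_cases s : alternating s ->
  [\/ odd (size s) /\ (exists n, s = 0 :: twos n),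
      odd (size s) /\ (exists n x, s = rev (twos n) ++ [:: 0, 1 & x]),
      ~~ odd (size s) /\
        (exists m n q, is_pair q /\ s = rev (twos m) ++ q ++ twos n)
    | good_factor s \/ good_factor (rev s)].
Proof.
elim=> [q /orP[/eqP->|pair_q] | q {}s token_q alt_s IHs].
- by apply: Or41; split=> //; exists 0.
- apply: Or43; split; first by case/orP: pair_q => /eqP->.
  by exists 0, 0, q; rewrite cats0.
have size_q : odd (size (q ++ 2 :: s)) = ((q == [:: 0]) == odd (size s)).
  by rewrite size_cat oddD /=; case/or3P: token_q => /eqP-> /=; case: odd.
have pairN0 : is_pair q -> (q == [:: 0]) = false by case/orP=> /eqP->.
rewrite size_q.
case: IHs => [[odd_s [n def_s]] | [odd_s [n [x def_s]]]
             | [even_s [m [n [p [pair_p def_s]]]]] | good_s].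
- have def_2s : 2 :: s = twos n.+1 by rewrite def_s.
  rewrite def_2s odd_s; case/orP: token_q => [/eqP-> | pair_q].
    by apply: Or41; split=> //; exists n.+1.
  apply: Or43; split; first by rewrite pairN0.
  by exists 0, n.+1, q.
(* A walk from a new pair [q] to the right meets the first pair of [s] as 0 before 1. *)
- case/or3P: token_q => /eqP def_q; rewrite def_q odd_s.
  + apply: Or42; split=> //; exists n.+1, x.
    by rewrite rev_twosS def_s.
  + apply: Or44; left; exists [::], x, [:: 0; 1], n; split=> //.
    by rewrite def_s -cat_cons cons_rev_twos -!catA.
  apply: Or44; left; exists [::], x, [:: 1; 0], n; split=> //.
  by rewrite def_s -cat_cons cons_rev_twos -!catA.
- case/or3P: token_q => /eqP def_q; rewrite def_q.
  + apply: Or43; split; first by rewrite eqxx eq_sym; case: odd even_s.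
    by exists m.+1, n, p; rewrite rev_twosS def_s.
  + case/orP: pair_p => /eqP def_p.
    * apply: Or44; left; exists [::], (twos n), [:: 0; 1], m; split=> //.
      by rewrite def_s def_p -cat_cons cons_rev_twos -!catA.
    (* Between [0 1] and [1 0] the 1 comes first from both sides; the leading [0 1] waits for a
       further pair. *)
    * apply: Or42; split; first by case: odd even_s.
      exists 0; eexists; reflexivity.
  (* From [p] leftwards, the pair [1 0] is met as 0 before 1, whichever pair [p] is. *)
  apply: Or44; right; exists (rev (twos n)), [::], (rev p), m; split.
    exact: rev_pair.
  rewrite def_s !rev_cat rev_cons !rev_cat revK -!cats1 -!catA.
  by rewrite [_ :: _]/=.
apply: Or44; case: good_s => [good_s | good_s].
  by left; rewrite -cat_rcons; apply: good_factor_cat.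
by right; rewrite -cat_rcons; apply: good_factor_rev_cat.
Qed.

Lemma odd_reaches r s : sumn s = r.*2.+1 -> size s = r.*2.+2 ->
  reaches s [:: 0, 1 & stairs 1 r].
Proof.
move=> sum_s size_s; case: (boolP (has_suffix light3 s)) => [light_s | heavy_s].
  (* For [r = 0] the string is [0 1] or [1 0], which has no light window. *)
  case: r sum_s size_s => [|r] sum_s size_s; last exact: reaches_light3.
  case: s size_s sum_s light_s => [|x [|y []]] //= _ sum_s.
  by case: x y sum_s => [|x] [|y] //; rewrite ?orbF //; case: x.
have [|alt_s] := heavy3_structure heavy_s; first by lia.
have even_s : odd (size s) = false by rewrite size_s /= odd_double.
case: (alternating_cases alt_s); rewrite ?even_s => -[] //.
- move=> _ [m [n [q [pair_q def_s]]]].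
  have def_r : r = m + n.
    move: size_s; rewrite def_s !size_cat size_rev !size_twos.
    by case/orP: pair_q => /eqP-> /=; lia.
  have tr_w := trace_twos 1 m n.
  case/orP: pair_q => /eqP def_q; rewrite def_s def_r def_q.
    exists (twos m), [:: 0, 1 & twos n], [:: 0, 1 & stairs 1 (m + n)].
    by split; [| do 2!constructor | exact: lexle_refl].
  exists (1 :: twos m), (0 :: twos n), [:: 0, 1 & stairs 1 (m + n)].
  by split; [rewrite rev_cons cat_rcons | do 2!constructor | exact: lexle_refl].
- by move=> good_s; apply: reaches_good.
by move=> good_s; rewrite -[s]revK; apply: reaches_rev; apply: reaches_good; rewrite ?size_rev.
Qed.

(** * From traces to searches *)

(* Each letter of o extends the interval [l, r) by one position. *)
Fixpoint grows (l r : nat) (o : seq nat) : bool :=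
  if o is x :: o' then (x.+1 == l) && grows x r o' || (x == r) && grows l r.+1 o'
  else true.

(** [m] is the block already explored. It is arbitrary because each step of the induction moves a
    letter of [u] or [v] into it; a whole walk has [m] empty. *)
Lemma trace_order t u v w : trace t u v w -> forall m,
  exists o, [/\ perm_eq o (iota 0 (size u) ++ iota (size u + size m) (size v)),
    grows (size u) (size u + size m) o
    & w = scanl addn t [seq nth 0 (rev u ++ m ++ v) x | x <- o]].
Proof.
elim=> {t u v w} [t m | t x u v w _ IH m | t x u v w _ IH m]; first by exists [::].
- have [o [perm_o grows_o def_w]] := IH (x :: m); exists (size u :: o).
  have -> : iota 0 (size (x :: u)) = iota 0 (size u) ++ [:: size u].
    by rewrite /= -[_ :: _]/(iota 0 (size u).+1) -addn1 iotaD.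
  rewrite /= addSnnS rev_cons cat_rcons; split; last first.
  + by rewrite def_w nth_cat size_rev ltnn subnn.
  + by rewrite eqxx grows_o.
  rewrite -catA perm_sym perm_catCA perm_cons perm_sym.
  exact: perm_o.
have [o [perm_o grows_o def_w]] := IH (rcons m x); exists (size u + size m :: o).
move: perm_o grows_o def_w; rewrite size_rcons addnS cat_rcons => perm_o grows_o def_w.
split; last first.
- by rewrite /= def_w nth_cat size_rev ltnNge leq_addr addKn nth_cat ltnn subnn.
- by rewrite /= eqxx grows_o orbT.
by rewrite /= perm_sym -cat1s perm_catCA perm_cons perm_sym.
Qed.

Lemma grows_interval l r o1 x o2 : l <= r -> grows l r (o1 ++ x :: o2) ->
  exists l' r', (forall y, (y \in o1) || (l <= y < r) = (l' <= y < r')) /\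
    (x.+1 = l' \/ x = r').
Proof.
elim: o1 l r => [|y o1 IH] l r le_lr /=.
  by case/orP=> /andP[/eqP def_x _]; exists l, r; split=> //; [left | right].
case/orP=> /andP[/eqP def_y grows_o].
  have [|l' [r' [mem_o1 def_x]]] := IH y r _ grows_o; first by lia.
  exists l', r'; split=> // z; rewrite -mem_o1 inE -def_y; lia.
have [|l' [r' [mem_o1 def_x]]] := IH l r.+1 _ grows_o; first by lia.
exists l', r'; split=> // z; rewrite -mem_o1 inE def_y; lia.
Qed.

Lemma size_search_U k p (S : search k p) : size (search_U S) = p.
Proof. by rewrite size_map size_tuple. Qed.

Lemma perm_prefix_min p (pi : {perm 'I_p}) i l r : l < r <= p ->
    (forall j : 'I_p, (j < i) = (l <= pi j < r)) ->
  \big[minn/p]_(j < p | j < i) pi j = l.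
Proof.
move=> /andP[lt_lr le_rp] itv; apply/eqP; rewrite eqn_leq; apply/andP; split.
  have lt_lp : l < p := leq_trans lt_lr le_rp.
  rewrite -minEnat -leEnat; apply: (@bigmin_inf _ _ _ _ ((pi^-1)%g (Ordinal lt_lp))).
    by rewrite leEnat itv permKV /= leqnn.
  by rewrite permKV.
elim/big_ind: _ => [|x y le_x le_y|j]; first by lia.
  by rewrite leq_min le_x.
by rewrite itv; case/andP.
Qed.

Lemma perm_prefix_max p (pi : {perm 'I_p}) i l r : l < r <= p ->
    (forall j : 'I_p, (j < i) = (l <= pi j < r)) ->
  (\max_(j < p | j < i) pi j).+1 = r.
Proof.
move=> /andP[lt_lr le_rp] itv; apply/eqP; rewrite eqn_leq; apply/andP; split.
  have [r' def_r] : exists r', r = r'.+1 by exists r.-1; lia.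
  rewrite def_r ltnS; apply/bigmax_leqP => j; rewrite itv def_r; lia.
have lt_rp : r.-1 < p by lia.
have := @leq_bigmax_cond _ (fun j : 'I_p => j < i) (fun j => pi j : nat)
  ((pi^-1)%g (Ordinal lt_rp)).
by rewrite itv permKV /= => /(_ _); lia.
Qed.

(** The search takes its permutation from the trace, all lower bounds 0, and the partial sums
    themselves as [U]. *)
Lemma reaches_search k p (B : p.-tuple nat) a : weight B = k -> reaches B a ->
  exists2 S : search k p, covers S B & lexle (search_U S) a.
Proof.
move=> wB [u [v [w [def_B tr_w le_wa]]]].
have [o []] := trace_order tr_w [::].
rewrite /= -def_B addn0 -[X in iota X (size v)]add0n -iotaD => perm_o grows_o def_w.
have size_uv : size u + size v = p by rewrite -(size_tuple B) def_B size_cat size_rev.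
have size_o : size o = p by rewrite (perm_size perm_o) size_iota.
have uniq_o : uniq o by rewrite (perm_uniq perm_o) iota_uniq.
have lt_o i : i < p -> nth 0 o i < p.
  move=> lt_ip; have : nth 0 o i \in o by rewrite mem_nth ?size_o.
  by rewrite (perm_mem perm_o) mem_iota size_uv.
pose f (i : 'I_p) := Ordinal (lt_o i (ltn_ord i)).
have inj_f : injective f.
  move=> i j /(congr1 val) /= /eqP; rewrite nth_uniq ?size_o // => /eqP; exact: val_inj.
pose pi := perm inj_f.
have conn_pi : connectivity pi.
  apply/forallP => i; apply/implyP => i_gt0.
  have def_o : o = take i o ++ nth 0 o i :: drop i.+1 o.
    by rewrite -drop_nth ?size_o // cat_take_drop.
  move: grows_o; rewrite def_o => grows_o.
  have [|l [r [mem_o def_x]]] := grows_interval _ grows_o; first by [].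
  have mem_take_o y : (y \in take i o) = (l <= y < r) by rewrite -mem_o; lia.
  have itv (j : 'I_p) : (j < i) = (l <= pi j < r).
    by rewrite -mem_take_o permE /= in_take ?mem_nth ?size_o // index_uniq ?size_o.
  have lt_lr : l < r.
    have := itv (Ordinal (ltn_trans i_gt0 (ltn_ord i))); rewrite /= i_gt0; lia.
  have le_rp : r <= p.
    have : r.-1 \in take i o by rewrite mem_take_o; lia.
    by move/mem_take; rewrite (perm_mem perm_o) mem_iota size_uv; lia.
  have lrp : l < r <= p by rewrite lt_lr.
  rewrite (perm_prefix_min lrp itv) (perm_prefix_max lrp itv) permE /=.
  by case: def_x => <-; rewrite eqxx ?orbT.
have size_w : size w = p by rewrite (trace_size tr_w).
(* Partial sums never exceed the weight [k], so they are legal letters of [U]; past the end [nth]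
   gives 0. *)
have le_w i : nth 0 w i < k.+1.
  have [lt_i | le_i] := ltnP i (size w); last by rewrite nth_default.
  rewrite ltnS -wB; have := trace_bound tr_w (mem_nth 0 lt_i).
  suff -> : weight B = 0 + sumn u + sumn v by [].
  rewrite add0n -sumn_rev -sumn_cat -def_B sumnE /weight big_tuple.
  by [].
pose U := [tuple Ordinal (le_w i) | i < p].
pose L := [tuple (ord0 : 'I_k.+1) | i < p].
pose S : search k p := Sub (pi, L, U) conn_pi.
have nth_mk (F : 'I_p -> 'I_k.+1) i (lt_ip : i < p) :
    nth 0 (map val [tuple F i | i < p]) i = F (Ordinal lt_ip).
  rewrite (nth_map ord0) ?size_tuple //.
  by have /= -> := nth_mktuple F ord0 (Ordinal lt_ip).
have def_U : search_U S = w.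
  apply: (@eq_from_nth _ 0); first by rewrite size_map size_tuple.
  move=> i; rewrite size_map size_tuple => lt_ip.
  by rewrite nth_mk.
exists S; last by rewrite def_U.
move=> i; rewrite def_U; apply/andP; split.
  suff -> : nth 0 (search_L S) i.+1 = 0 by [].
  have [lt_ip | le_pi] := ltnP i.+1 p; last by rewrite nth_default // size_map size_tuple.
  by rewrite nth_mk.
rewrite def_w nth_scanl ?size_map ?size_o //.
set m := map _ _; have size_m : size m = p by rewrite size_map.
have -> : foldl addn 0 (take i.+1 m) = sumn (take i.+1 m).
  have foldl_sumn t s : foldl addn t s = t + sumn s.
    by elim: s t => [|x s IHs] t /=; rewrite ?addn0 // IHs addnA.
  by rewrite foldl_sumn.
rewrite sumnE (big_nth 0) size_takel ?size_m // big_mkord.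
rewrite (big_ord_widen p (fun j => nth 0 (take i.+1 m) j)) //.
apply: leq_sum => j le_ji; rewrite nth_take // (nth_map 0) ?size_o //.
by rewrite (tnth_nth 0) /search_perm /= permE.
Qed.

(** * Lower bounds from sums over intervals of parts *)

Lemma connectivity_interval p (pi : {perm 'I_p}) i : connectivity pi -> i < p ->
  exists l, l + i < p /\ forall j : 'I_p, (j <= i) = (l <= pi j <= l + i).
Proof.
(* The minimum and maximum in [connectivity] are the ends of the interval filled so far, and the
   next part extends one of them. *)
move=> /forallP conn_pi; elim: i => [|i IHi] lt_ip.
  exists (pi (Ordinal lt_ip)); rewrite addn0; split=> // j.
  by rewrite -eqn_leq leqn0 [RHS]eq_sym (inj_eq val_inj) (inj_eq perm_inj).
have [l [lt_lip itv]] := IHi (ltnW lt_ip).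
have lrp : l < (l + i).+1 <= p by lia.
have itv' (j : 'I_p) : (j < i.+1) = (l <= pi j < (l + i).+1) by rewrite !ltnS itv.
have := conn_pi (Ordinal lt_ip).
rewrite /= (perm_prefix_min lrp itv').
have [->] := perm_prefix_max lrp itv'.
have step (j : 'I_p) : (j <= i.+1) = (pi j == pi (Ordinal lt_ip) :> nat) || (l <= pi j <= l + i).
  by rewrite leq_eqVlt ltnS itv (inj_eq val_inj) (inj_eq perm_inj).
have lt_pi := ltn_ord (pi (Ordinal lt_ip)).
case/orP=> /eqP def_pi.
  by exists l.-1; split=> [|j]; [lia | rewrite step; lia].
by exists l; split=> [|j]; [lia | rewrite step; lia].
Qed.

(** For monotone [b], the sum over an interval of parts telescopes to a difference of two values of
    [b]. *)
Definition increments (b : nat -> nat) (p : nat) : p.-tuple nat :=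
  [tuple b i.+1 - b i | i < p].

Lemma weight_increments b p : {homo b : x y / x <= y} ->
  weight (increments b p) = b p - b 0.
Proof.
move=> b_homo; rewrite -(telescope_sumn _ _ b_homo) big_mkord.
by apply: eq_bigr => i _; rewrite tnth_mktuple.
Qed.

Lemma covers_increments k p b (S : search k p) i :
    {homo b : x y / x <= y} -> covers S (increments b p) -> i < p ->
  exists l, [/\ l + i < p,
    forall j : 'I_p, (j <= i) = (l <= search_perm S j <= l + i)
    & b (l + i).+1 - b l <= nth 0 (search_U S) i].
Proof.
move=> b_homo cov lt_ip.
have [l [lt_lip itv]] := connectivity_interval (valP S) lt_ip.
exists l; split=> //; have /andP[_] := cov (Ordinal lt_ip); apply: leq_trans.
rewrite /= -(telescope_sumn _ _ b_homo).
rewrite (big_nat_widenl _ 0) // (big_nat_widen _ _ p) // big_mkord.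
rewrite (reindex_inj (@perm_inj _ (search_perm S))) /=.
rewrite (eq_bigl (fun j : 'I_p => j <= i)) => [|j]; last by rewrite itv ltnS.
by apply: leq_sum => j _; rewrite tnth_mktuple.
Qed.

(** The optimal scheme consists of all searches with U-string at most [a]. Every scheme must cover
    [A], which forces a U-string of at least [a]; in the optimal scheme this U-string equals [a]. *)
Lemma alpha_criterion k p a (A : p.-tuple nat) : weight A = k ->
    (forall S : search k p, covers S A -> lexle a (search_U S)) ->
    (forall B : p.-tuple nat, weight B = k -> reaches B a) ->
  is_alpha k p a.
Proof.
move=> wA hard_A all_reach.
pose SS := [set S : search k p | lexle (search_U S) a].
have schemeSS : is_scheme SS.
  move=> B wB; have [S covS le_Sa] := reaches_search wB (all_reach B wB).
  by exists S; rewrite ?inE.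
split; last first.
  move=> TT c schemeTT [_ max_c]; have [S TTS covS] := schemeTT A wA.
  exact: (@le_trans _ (seqlexi nat)) (hard_A S covS) (max_c S TTS).
exists SS => //; split; last by move=> S; rewrite inE.
have [S] := schemeSS A wA; rewrite inE => le_Sa covS.
by exists S; rewrite ?inE //; apply: lexle_anti (hard_A S covS).
Qed.

(** * The values for even and odd k *)

Lemma weight_sumn p (B : p.-tuple nat) : weight B = sumn B.
Proof. by rewrite sumnE big_tuple. Qed.

Lemma even_alpha r : is_alpha r.*2 r.*2.+1 (0 :: stairs 0 r).
Proof.
(* Partial sums of 0 2 0 2 ... 0. Among windows of a given length the leftmost is lightest, so the
   bound holds letter by letter. *)
pose b n := n./2.*2.
have b_homo : {homo b : x y / x <= y} by move=> x y; rewrite /b; lia.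
apply: (alpha_criterion (A := increments b r.*2.+1)).
- by rewrite weight_increments // /b; lia.
- move=> S cov; apply: lexle_of_nth; rewrite ?size_search_U /= size_stairs //.
  move=> i lt_ip _; have [l [lt_lip _ le_U]] := covers_increments b_homo cov lt_ip.
  apply: leq_trans le_U; rewrite /b; case: i lt_ip lt_lip => [|i] lt_ip lt_lip //=.
  by rewrite nth_stairs //; lia.
move=> B wB; apply: even_reaches; last exact: size_tuple.
by rewrite -weight_sumn.
Qed.

Lemma odd_alpha r : is_alpha r.*2.+1 r.*2.+2 [:: 0, 1 & stairs 1 r].
Proof.
(* Partial sums 0 0 1 3 3 5 5 ... of 0 1 2 0 2 0 ... 2 0; the subtracted term corrects the values at
   0 and 1. *)
pose b n := n.-1./2.*2.+1 - (n < 2).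
have b_homo : {homo b : x y / x <= y}.
  by move=> x y; rewrite /b; lia.
apply: (alpha_criterion (A := increments b r.*2.+2)).
- by rewrite weight_increments // /b /=; lia.
- move=> S cov; apply: lexle_of_nth; rewrite ?size_search_U /= size_stairs //.
  case=> [|[|i]] //= lt_ip eq_U.
    have [l [_ _]] := covers_increments b_homo cov lt_ip.
    by apply: leq_trans; rewrite /b; lia.
  (* Later windows such as [0 2 0] can be lighter than claimed, so agreement on the first two
     letters 0 1 is used: it makes part 0 the first and part 1 the second, and every explored
     interval then starts at 0. *)
  have [l0 [_ itv0]] := covers_increments b_homo cov (ltn0Sn _).
  have [l1 [_ itv1]] := covers_increments b_homo cov (isT : 1 < r.*2.+2).
  rewrite -(eq_U 0) // -(eq_U 1) //= => le_U1 le_U0.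
  have [l [lt_lip itv le_U]] := covers_increments b_homo cov lt_ip.
  have l1_0 : l1 = 0 by move: le_U1; rewrite /b; lia.
  have [lt0 l0_le] : search_perm S ord0 = l0 :> nat /\ l0 <= 1.
    have := itv0 ord0; have := itv1 ord0; rewrite /= l1_0; lia.
  have l0_0 : l0 = 0 by move: le_U0; rewrite /b; lia.
  have l_0 : l = 0 by have := itv ord0; rewrite lt0 l0_0 /=; lia.
  by apply: leq_trans le_U; rewrite l_0 nth_stairs // /b /=; lia.
move=> B wB; apply: odd_reaches; last exact: size_tuple.
by rewrite -weight_sumn.
Qed.

Theorem theorem1 (k : nat) :
  (odd k ->
     is_alpha k k.+1
       ([:: 0; 1] ++ flatten [seq [:: m.*2.+1; m.*2.+1] | m <- iota 1 k./2])) /\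
  (~~ odd k ->
     is_alpha k k.+1
       (0 :: flatten [seq [:: m.*2; m.*2] | m <- iota 1 k./2])).
Proof.
rewrite (stairs_odd 0) (stairs_even 0); split=> [odd_k | even_k].
  have -> : k = k./2.*2.+1 by rewrite -[LHS]odd_double_half odd_k.
  rewrite /= uphalf_double; exact: odd_alpha.
have -> : k = k./2.*2 by rewrite -[LHS]odd_double_half (negbTE even_k).
rewrite doubleK; exact: even_alpha.
Qed.
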